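(* Fix $m\ge 2$ and a probability vector $\pi=(\pi_C,\pi_R,\pi_{S_1},\dots,\pi_{S_m})$ on the $m+2$ types $C,R,S_1,\dots,S_m$, with all entries strictly positive. For each $n$ let $G_n$ be a random simple graph on $n$ nodes with node degrees $d_1,\dots,d_n$. Assume: (i) $\sup_n \frac1n\sum_{i=1}^n d_i^2<\infty$ (there is a deterministic constant $M$ such that almost surely $\frac1n\sum_i d_i^2\le M$ for every $n$); (ii) there exist constants $\alpha>0$ and $K>0$ such that, for all sufficiently large $n$, almost surely the subgraph of $G_n$ induced on $V_n^*=\{i: d_i\equiv 1\pmod m,\ d_i\le K\}$ contains at least $\alpha n$ edges; (iii) the types of the $n$ players are drawn independently (of each other and of the graph) according to $\pi$. Then the probability that the resulting $m$-strategy CRS game on $G_n$ admits a pure strategy Nash equilibrium (PNE) tends to $0$ as $n\to\infty$.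
   Context: A player of type $C$ is a conformist, of type $R$ a rebel, and of type $S_k$ a stubborn agent with fixed strategy $a_k$. An $m$-strategy CRS game consists of a finite set of players $N=C\cup R\cup S$ (conformists, rebels, stubborn agents), an undirected loopless graph on $N$ (with $N_i$ the set of neighbors of $i$), and a strategy set $A=\{a_1,\dots,a_m\}$ common to all players. Stubborn agents never change their fixed strategy, so strategy profiles $\boldsymbol x\in A^N$ always have $x_i$ equal to the fixed strategy for $i\in S$. Payoffs are $u_i(\boldsymbol x)=|\{j\in N_i: x_j=x_i\}|$ for $i\in C$, $u_i(\boldsymbol x)=|\{j\in N_i: x_j\ne x_i\}|$ for $i\in R$, and $u_i(\boldsymbol x)=0$ for $i\in S$. A profile $\boldsymbol x^*$ is a PNE if no conformist or rebel $i$ can strictly increase $u_i$ by unilaterally changing its strategy: $u_i(\boldsymbol x^* )\ge u_i(x_i,\boldsymbol x^*_{-i})$ for all $x_i\in A$. *)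

(* Defs.v *)
(* MathComp / MathComp-Analysis *)
From HB Require Import structures.
From mathcomp Require Import all_boot all_order all_algebra.
From mathcomp Require Import all_classical all_reals all_analysis.

Set Implicit Arguments.
Unset Strict Implicit.
Unset Printing Implicit Defensive.

Import Order.TTheory GRing.Theory Num.Theory.
Import numFieldNormedType.Exports.

Local Open Scope classical_set_scope.
Local Open Scope ring_scope.

(* Edges are two-element sets of vertices, so the graph is undirected, loopless
   and has no multiple edges. *)
Record sgraph (V : finType) := SGraph {
  edges : {set {set V}};
  edges_card2 : [forall e in edges, #|e| == 2]
}.

HB.instance Definition _ (V : finType) := [isSub for @edges V].
HB.instance Definition _ (V : finType) := [Finite of sgraph V by <:].

Section SimpleGraph.
Context {V : finType}.
Implicit Types (G : sgraph V) (i j : V) (W : {set V}).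

Lemma empty_graph_subproof : [forall e in (finset.set0 : {set {set V}}), #|e| == 2].
Proof. by apply/forall_inP => e; rewrite inE. Qed.

Definition empty_graph : sgraph V := SGraph empty_graph_subproof.

Definition neighbors G i : {set V} := [set j | [set i; j]%SET \in edges G]%SET.

Definition degree G i : nat := #|neighbors G i|.

Definition induced_edges G W : {set {set V}} :=
  [set e in edges G | e \subset W]%SET.

End SimpleGraph.

Variant player_type (m : nat) :=
  | Conformist
  | Rebel
  | Stubborn of 'I_m.

Arguments Conformist {m}.
Arguments Rebel {m}.

Section PlayerTypeFinite.
Variable m : nat.

Definition player_type_encode (t : player_type m) : option (option 'I_m) :=
  match t with
  | Conformist => None
  | Rebel => Some None
  | Stubborn k => Some (Some k)
  end.

Definition player_type_decode (o : option (option 'I_m)) : player_type m :=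
  match o with
  | None => Conformist
  | Some None => Rebel
  | Some (Some k) => Stubborn k
  end.

Lemma player_type_encodeK : cancel player_type_encode player_type_decode.
Proof. by case. Qed.

HB.instance Definition _ := Finite.copy (player_type m)
  (can_type player_type_encodeK).

End PlayerTypeFinite.

(* Graphs and player types carry the discrete sigma-algebra. *)
HB.instance Definition _ (V : finType) :=
  isPointed.Build (sgraph V) empty_graph.
HB.instance Definition _ (V : finType) :=
  @isMeasurable.Build default_measure_display (sgraph V)
    discrete_measurable discrete_measurable0
    discrete_measurableC discrete_measurableU.

HB.instance Definition _ (m : nat) :=
  isPointed.Build (player_type m) Conformist.
HB.instance Definition _ (m : nat) :=
  @isMeasurable.Build default_measure_display (player_type m)
    discrete_measurable discrete_measurable0
    discrete_measurableC discrete_measurableU.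

(* The CRS game on the graph [G] with type assignment [t]; the strategy [a_k]
   is represented by its index [k : 'I_m]. *)
Section CRSGame.
Variables (m : nat) (V : finType) (G : sgraph V) (t : V -> player_type m).
Implicit Types (x : {ffun V -> 'I_m}) (i : V) (a : 'I_m).

Definition is_profile x : Prop := forall i k, t i = Stubborn k -> x i = k.

Definition payoff x i : nat :=
  match t i with
  | Conformist => #|[set j in neighbors G i | x j == x i]%SET|
  | Rebel => #|[set j in neighbors G i | x j != x i]%SET|
  | Stubborn _ => 0
  end.

Definition deviate x i a : {ffun V -> 'I_m} :=
  [ffun j => if j == i then a else x j].

Definition is_PNE x : Prop :=
  is_profile x /\
  forall i, t i = Conformist \/ t i = Rebel ->
    forall a, (payoff (deviate x i a) i <= payoff x i)%N.

Definition has_PNE : Prop := exists x, is_PNE x.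

End CRSGame.

Section Independence.
Context d (T : measurableType d) (R : realType) (P : probability T R).

Definition mutually_independent (I : finType) (F : I -> set (set T)) : Prop :=
  forall (J : {set I}) (E : I -> set T),
    (forall i, i \in J -> F i (E i)) ->
    P (\bigcap_(i in [set` J]) E i) = (\prod_(i in J) P (E i))%E.

Definition generated_by d' (T' : measurableType d') (X : {RV P >-> T'}) :
    set (set T) :=
  preimage_set_system setT X measurable.

(* The index [None] stands for the graph, [Some i] for the type of player [i]. *)
Definition types_and_graph_independent (m : nat) (V : finType)
    (G : {RV P >-> sgraph V}) (tau : V -> {RV P >-> player_type m}) : Prop :=
  mutually_independent (fun o : option V =>
    match o with
    | None => generated_by G
    | Some i => generated_by (tau i)
    end).

End Independence.

(* Main.v *)
(* Let [i j] be an edge whose endpoints have degree 1 modulo [m].  If [i] is a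
   conformist, [j] a rebel, and the other neighbours of [i], as well as those of
   [j], are stubborn and equidistributed over the strategies, then [i] pursues
   [j] while [j] flees [i], so no PNE exists.  Such a pattern constrains at most
   2K players, hence occurs at a given edge with probability bounded below.  The
   patterns of two edges are independent unless the neighbourhoods of the edges
   meet; a vertex [v] is close to at most [K * deg v] low-degree edges, so by the
   second moment hypothesis only O(n) pairs of edges are dependent.  Chebyshev's
   inequality then bounds the probability that no pattern occurs by
   O(n) / (alpha n)^2. *)
Require Import Defs.
From HB Require Import structures.
From mathcomp Require Import all_boot all_order all_algebra.
From mathcomp Require Import all_classical all_reals all_analysis.
From mathcomp Require Import zify ring.

Import Order.TTheory GRing.Theory Num.Theory.
Import numFieldNormedType.Exports.

Set Implicit Arguments.
Unset Strict Implicit.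
Unset Printing Implicit Defensive.

(** * Colourings that split two sets evenly among the strategies *)

Lemma count_modn_iota (m a q : nat) : (a < m)%N ->
  count (fun k => k %% m == a) (iota 0 (q * m)) = q.
Proof.
move=> am; have m0 : 0 < m by apply: leq_ltn_trans am.
elim: q => [|q IHq] //; rewrite mulSn addnC iotaD count_cat IHq add0n.
rewrite -[RHS]addn1; congr addn.
rewrite -[q * m]addn0 iotaDl count_map.
rewrite (@eq_in_count _ _ (pred1 a)) => [|k]; last first.
  by rewrite mem_iota /= add0n => km; rewrite modnMDl modn_small.
by rewrite count_uniq_mem ?iota_uniq // mem_iota am.
Qed.

Lemma map_index_iota (T : eqType) (s : seq T) : uniq s ->
  [seq index x s | x <- s] = iota 0 (size s).
Proof.
case: s => [//|x0 s] us; apply: (@eq_from_nth _ 0) => [|k].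
  by rewrite size_map size_iota.
rewrite size_map => ks.
by rewrite (nth_map x0) // index_uniq // nth_iota.
Qed.

(** Along [s] the elements of [A] get the indices from 0 to [#|A|] - 1, a whole number of blocks of
    length [m]; each block meets every residue once. *)
Lemma card_index_mod {V : finType} (A : {set V}) (s : seq V) (m a : nat) :
    a < m -> m %| #|A| -> uniq s -> s =i A ->
  #|[set v in A | index v s %% m == a]%SET| = #|A| %/ m.
Proof.
move=> am /dvdnP[q Aq] us sA.
have szs : size s = q * m by rewrite -Aq -(eq_card sA); apply/esym/card_uniqP.
rewrite Aq mulnK ?(leq_ltn_trans _ am) // -[RHS](@count_modn_iota m a) //.
rewrite -szs -map_index_iota // count_map -size_filter.
rewrite -(card_uniqP (filter_uniq _ us)); apply: eq_card => v.
by rewrite !inE mem_filter sA /= andbC.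
Qed.

(* Listing the common elements first makes the two listings assign the same
   index, hence the same residue, to every element of the intersection. *)
Lemma balanced_colouring {V : finType} (A B : {set V}) (m : nat) :
    0 < m -> m %| #|A| -> m %| #|B| ->
  exists c : V -> 'I_m, forall a,
    #|[set v in A | c v == a]%SET| = #|A| %/ m /\
    #|[set v in B | c v == a]%SET| = #|B| %/ m.
Proof.
move=> m0 mA mB.
pose l X Y : seq V := enum (X :&: Y)%SET ++ enum (X :\: Y)%SET.
have ul X Y : uniq (l X Y).
  rewrite cat_uniq !enum_uniq andbT; apply/hasPn => v.
  by rewrite !mem_enum !inE => /andP[/negPf ->]; rewrite andbF.
have lE X Y : l X Y =i X.
  by move=> v; rewrite mem_cat !mem_enum !inE; case: (v \in Y); rewrite ?andbT ?andbF ?orbF.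
exists (fun v => Ordinal (ltn_pmod (index v (if v \in A then l A B else l B A)) m0)).
move=> a; split.
  rewrite -(card_index_mod (ltn_ord a) mA (ul A B) (lE A B)).
  by apply: eq_card => v; rewrite !inE -val_eqE /=; case: (v \in A).
rewrite -(card_index_mod (ltn_ord a) mB (ul B A) (lE B A)).
apply: eq_card => v; rewrite !inE -val_eqE /=.
case vB: (v \in B) => //=; case vA: (v \in A) => //.
by rewrite !index_cat !mem_enum !inE vA vB /= finset.setIC.
Qed.

(** * The pursuit pattern at an edge *)

Lemma mem_neighborsC {V : finType} (G : sgraph V) (i j : V) :
  (j \in neighbors G i) = (i \in neighbors G j).
Proof. by rewrite !inE finset.setUC. Qed.

Lemma notin_neighbors {V : finType} (G : sgraph V) (i : V) :
  i \notin neighbors G i.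
Proof.
rewrite inE; apply/negP => /(forall_inP (edges_card2 G)).
by rewrite finset.setUid cards1.
Qed.

Lemma degree_gt0 {V : finType} (G : sgraph V) (i j : V) :
  j \in neighbors G i -> 0 < degree G i.
Proof. by move=> ij; rewrite /degree (cardD1 j) ij. Qed.

(** Splits off [j], whose strategy is left open. In the application [r] does not depend on [a], so
    strategies differ only in the term [x j == a]. *)
Lemma card_neighbors_colour {V : finType} {m : nat} (G : sgraph V)
    (x : {ffun V -> 'I_m}) (c : V -> 'I_m) (i j : V) (a : 'I_m) (r : nat) :
    j \in neighbors G i ->
    (forall v, v \in (neighbors G i :\ j)%SET -> x v = c v) ->
    #|[set v in (neighbors G i :\ j)%SET | c v == a]%SET| = r ->
  #|[set v in neighbors G i | x v == a]%SET| = (x j == a) + r.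
Proof.
move=> ij xc <-; rewrite (cardsD1 j) !inE; congr (_ + _).
  by rewrite inE in ij; rewrite ij.
apply: eq_card => v; have := xc v; rewrite !inE.
case: (v == j) => //=; case: (_ \in edges G) => //= -> //.
Qed.

(** The graph is loopless, so a deviation of [i] leaves the strategies of its neighbours
    unchanged. *)
Lemma card_deviate_eq {V : finType} {m : nat} (G : sgraph V)
    (x : {ffun V -> 'I_m}) (i : V) (a : 'I_m) :
  #|[set v in neighbors G i | deviate x i a v == deviate x i a i]%SET| =
  #|[set v in neighbors G i | x v == a]%SET|.
Proof.
apply: eq_card => v; rewrite [LHS]inE [RHS]inE !ffunE eqxx.
by case: (eqVneq v i) => // ->; rewrite (negPf (notin_neighbors G i)).
Qed.

Lemma card_neq_colour {V : finType} {m : nat} (N : {set V})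
    (x : V -> 'I_m) (a : 'I_m) :
  #|[set v in N | x v == a]%SET| + #|[set v in N | x v != a]%SET| = #|N|.
Proof.
rewrite -(cardsID [set v | x v == a]%SET N); congr (_ + _).
  by apply: eq_card => v; rewrite !inE.
by apply: eq_card => v; rewrite !inE andbC.
Qed.

(* The conformist [i] wants to copy the rebel [j], who wants to differ from
   [i]; balanced stubborn neighbours leave each of them no other incentive. *)
Lemma no_PNE_pursuit {V : finType} {m : nat} (G : sgraph V)
    (t : V -> player_type m) (c : V -> 'I_m) (i j : V) (ri rj : nat) :
    1 < m -> j \in neighbors G i ->
    t i = Conformist -> t j = Rebel ->
    (forall v, v \in (neighbors G i :\ j)%SET -> t v = Stubborn (c v)) ->
    (forall v, v \in (neighbors G j :\ i)%SET -> t v = Stubborn (c v)) ->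
    (forall a, #|[set v in (neighbors G i :\ j)%SET | c v == a]%SET| = ri) ->
    (forall a, #|[set v in (neighbors G j :\ i)%SET | c v == a]%SET| = rj) ->
  ~ has_PNE G t.
Proof.
move=> m1 ij ti tj Si Sj ci cj [x [xprof xne]].
have ji : i \in neighbors G j by rewrite mem_neighborsC.
have Ni a : #|[set v in neighbors G i | x v == a]%SET| = (x j == a) + ri.
  by apply: (card_neighbors_colour ij _ (ci a)) => v /Si; apply: xprof.
have Nj a : #|[set v in neighbors G j | x v == a]%SET| = (x i == a) + rj.
  by apply: (card_neighbors_colour ji _ (cj a)) => v /Sj; apply: xprof.
have xij : x i = x j.
  have := xne i (or_introl ti) (x j).
  rewrite /payoff ti card_deviate_eq !Ni eqxx leq_add2r.
  by case: eqP.
have [a ax] : exists a : 'I_m, x i != a.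
  pose a0 : 'I_m := Ordinal (ltnW m1); pose a1 : 'I_m := Ordinal m1.
  by case: (eqVneq (x i) a0) => [->|]; [exists a1|exists a0].
(* Since [x i = x j], the rebel [j] differs from all but [1 + rj] neighbours, and would differ from
   all but [rj] after moving to [a]. *)
have := xne j (or_intror tj) a; rewrite /payoff tj.
have := card_neq_colour (neighbors G j) (deviate x j a) (deviate x j a j).
rewrite card_deviate_eq Nj (negPf ax).
have := card_neq_colour (neighbors G j) x (x j).
rewrite Nj xij eqxx.
lia.
Qed.

(** For an edge this contains both endpoints, each being a neighbour of the other, so it holds every
    player that the pattern constrains. *)
Definition edge_nbhd {V : finType} (G : sgraph V) (e : {set V}) : {set V} :=
  (\bigcup_(i in e) neighbors G i)%SET.

Lemma edgeP {V : finType} (G : sgraph V) (e : {set V}) : e \in edges G ->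
  exists i j, [/\ e = [set i; j]%SET, i != j & j \in neighbors G i].
Proof.
move=> eG; have /cards2P[i [j [ij eij]]] := forall_inP (edges_card2 G) e eG.
by exists i, j; split=> //; rewrite inE -eij.
Qed.

(** The congruence makes the number of neighbours other than the opposite endpoint divisible by [m],
    so they split evenly. A common neighbour of both endpoints has one type, hence a single
    colouring [c] must serve both sides. *)
Lemma exists_no_PNE_pattern {V : finType} {m : nat} (G : sgraph V)
    (e : {set V}) : 1 < m -> e \in edges G ->
    (forall i, i \in e -> degree G i == 1 %[mod m]) ->
  exists s : {ffun V -> player_type m}, forall t : V -> player_type m,
    (forall v, v \in edge_nbhd G e -> t v = s v) -> ~ has_PNE G t.
Proof.
move=> m1 /edgeP[i [j [-> ij jNi]]] deg.
have iNj : i \in neighbors G j by rewrite mem_neighborsC.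
have dvd u v : u \in [set i; j]%SET -> v \in neighbors G u ->
    m %| #|(neighbors G u :\ v)%SET|.
  move=> /deg; rewrite /degree => degu vNu; rewrite eqn_mod_dvd in degu.
    by rewrite (cardsD1 v) vNu add1n subn1 in degu.
  exact: degree_gt0 vNu.
have [c cP] := balanced_colouring (ltnW m1)
  (dvd i j (set21 i j) jNi) (dvd j i (set22 i j) iNj).
exists [ffun v => if v == i then Conformist
  else if v == j then Rebel else Stubborn (c v)] => t ts.
have S u w : u \in [set i; j]%SET -> w \in neighbors G u -> w \in edge_nbhd G [set i; j]%SET.
  by move=> ue wu; apply/bigcupP; exists u.
apply: (no_PNE_pursuit m1 jNi (c := c)
  (ri := #|(neighbors G i :\ j)%SET| %/ m)
  (rj := #|(neighbors G j :\ i)%SET| %/ m)).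
- by rewrite ts ?ffunE ?eqxx // (S j) ?set22.
- by rewrite ts ?ffunE ?eqxx ?(eq_sym j) ?(negPf ij) // (S i) ?set21.
- move=> v; rewrite in_setD1 => /andP[vj vNi]; rewrite ts ?(S i) ?set21 // ffunE (negPf vj).
  by case: eqP vNi => // ->; rewrite (negPf (notin_neighbors G i)).
- move=> v; rewrite in_setD1 => /andP[vi vNj]; rewrite ts ?(S j) ?set22 // ffunE (negPf vi).
  by case: eqP vNj => // ->; rewrite (negPf (notin_neighbors G j)).
- by move=> a; case: (cP a).
- by move=> a; case: (cP a).
Qed.

(** * Sizes and overlaps of edge neighbourhoods *)

Lemma card_edge_nbhd {V : finType} (G : sgraph V) (e : {set V}) (k : nat) :
    e \in edges G -> (forall i, i \in e -> degree G i <= k) ->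
  #|edge_nbhd G e| <= k.*2.
Proof.
move=> /edgeP[i [j [-> ij _]]] deg.
rewrite /edge_nbhd big_setU1 ?inE //= big_set1.
apply: leq_trans (leq_card_setU _ _) _.
by rewrite -addnn leq_add // deg ?set21 ?set22.
Qed.

(** Such an edge has an endpoint [i] adjacent to [v]: at most [degree G v] choices of [i], then at
    most [k] of the other endpoint. *)
Lemma card_edges_near {V : finType} (G : sgraph V) (A : {set {set V}})
    (k : nat) (v : V) :
    {subset A <= edges G} ->
    (forall e i, e \in A -> i \in e -> degree G i <= k) ->
  #|[set e in A | v \in edge_nbhd G e]%SET| <= k * degree G v.
Proof.
move=> AG deg.
pose X := (\bigcup_(i in neighbors G v | (degree G i <= k)%N)
  [set [set i; j]%SET | j in neighbors G i])%SET.
apply: (@leq_trans #|X|).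
  apply/subset_leq_card/fintype.subsetP => e; rewrite inE => /andP[eA /bigcupP[i ie vNi]].
  apply/bigcupP; exists i; first by rewrite mem_neighborsC vNi (deg e).
  have [a [b [eab _ bNa]]] := edgeP (AG _ eA).
  move: ie; rewrite eab => /set2P[] ->; apply/imsetP.
    by exists b.
  by exists a; rewrite 1?mem_neighborsC // finset.setUC.
apply: (@leq_trans (\sum_(i in neighbors G v | (degree G i <= k)%N) k)).
  rewrite /X; elim/big_rec2: _ => [|i n Y /andP[_ di] Yn]; first by rewrite cards0.
  apply: leq_trans (leq_card_setU _ _) _.
  by rewrite leq_add // (leq_trans (leq_imset_card _ _)).
rewrite sum_nat_const mulnC leq_mul2l /degree; apply/orP; right.
apply/subset_leq_card/fintype.subsetP => i.
by case/andP.
Qed.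
Local Open Scope ring_scope.

(** * Independent types: pattern probabilities and a variance bound *)

Section ProductWeight.
Context {R : realFieldType} {V T : finType} (p : T -> R).
Hypothesis p_gt0 : forall a, 0 < p a.
Hypothesis p_sum1 : \sum_a p a = 1.
Implicit Types (S : {set V}) (s t : {ffun V -> T}).

(** The probability of [t] when types are drawn independently with law [p]; sums against it are
    expectations. *)
Definition prod_weight (t : {ffun V -> T}) : R := \prod_v p (t v).

Definition agree S s t : bool := [forall v in S, t v == s v].

Definition pattern_weight S s : R := \prod_(v in S) p (s v).

Lemma prod_weight_ge0 t : 0 <= prod_weight t.
Proof. by apply: prodr_ge0 => v _; apply: ltW. Qed.

Lemma sum_prod_weight (F : V -> T -> R) :
  \sum_t prod_weight t * (\prod_v F v (t v)) = \prod_v \sum_a p a * F v a.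
Proof. by rewrite bigA_distr_bigA; apply: eq_bigr => t _; rewrite -big_split. Qed.

Lemma sum_prod_weight1 : \sum_t prod_weight t = 1.
Proof.
rewrite /prod_weight -(bigA_distr_bigA (fun (_ : V) a => p a)).
by apply: big1 => v _; rewrite p_sum1.
Qed.

(** Puts the indicator in product form over all vertices, so that its expectation factors by
    [sum_prod_weight]. *)
Lemma agreeE S s t :
  (agree S s t)%:R = \prod_v (if v \in S then (t v == s v)%:R else 1) :> R.
Proof.
rewrite -big_mkcond /agree; case: forall_inP => [H|H] /=.
  by rewrite big1 // => v vS; rewrite H.
apply/esym/eqP; apply/prodf_eq0.
have /existsP[v] : [exists v, (v \in S) && (t v != s v)].
  apply: contra_notT H => /existsPn H v vS.
  by apply: contraT => tv; have := H v; rewrite vS tv.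
by case/andP => vS /negPf tv; exists v; rewrite // tv.
Qed.

Lemma sum_agree_factor S s (v : V) :
  \sum_a p a * (if v \in S then (a == s v)%:R else 1) =
  if v \in S then p (s v) else 1.
Proof.
case: ifP => _; last by under eq_bigr do rewrite mulr1.
rewrite (bigD1 (s v)) //= eqxx mulr1 big1 ?addr0 // => a /negPf ->.
by rewrite mulr0.
Qed.

Lemma sum_agree S s : \sum_t prod_weight t * (agree S s t)%:R = pattern_weight S s.
Proof.
under eq_bigr do rewrite agreeE.
rewrite (sum_prod_weight (fun v a => if v \in S then (a == s v)%:R else 1)).
by rewrite [RHS]big_mkcond; apply: eq_bigr => v _; rewrite sum_agree_factor.
Qed.

Lemma sum_agree2 S1 S2 s1 s2 : [disjoint S1 & S2] ->
  \sum_t prod_weight t * ((agree S1 s1 t)%:R * (agree S2 s2 t)%:R) =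
  pattern_weight S1 s1 * pattern_weight S2 s2.
Proof.
move=> dis; under eq_bigr do rewrite !agreeE -big_split /=.
rewrite (sum_prod_weight (fun v a =>
  (if v \in S1 then (a == s1 v)%:R else 1) *
  (if v \in S2 then (a == s2 v)%:R else 1))).
rewrite /pattern_weight [X in X * _]big_mkcond [X in _ * X]big_mkcond -big_split /=.
apply: eq_bigr => v _; rewrite -!sum_agree_factor.
case vS1: (v \in S1); last first.
  under eq_bigr do rewrite mul1r.
  by under [X in X * _]eq_bigr do rewrite mulr1; rewrite p_sum1 mul1r.
have -> : (v \in S2) = false by apply: (disjointFr dis).
under eq_bigr do rewrite mulr1.
by under [X in _ * X]eq_bigr do rewrite mulr1; rewrite p_sum1 mulr1.
Qed.

Lemma p_le1 a : p a <= 1.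
Proof.
by rewrite -p_sum1 (bigD1 a) //= lerDl sumr_ge0 // => b _; apply: ltW.
Qed.

Lemma pattern_weight_ge0 S s : 0 <= pattern_weight S s.
Proof. by apply: prodr_ge0 => v _; apply: ltW. Qed.

(** The product of all type probabilities is at most each single one, which gives a bound uniform
    over patterns of bounded support. *)
Lemma pattern_weight_lb S s k : (#|S| <= k)%N ->
  (\prod_a p a) ^+ k <= pattern_weight S s.
Proof.
move=> Sk; set q := \prod_a p a.
have q_ge0 : 0 <= q by apply: prodr_ge0 => a _; apply: ltW.
have qp a : q <= p a.
  rewrite /q (bigD1 a) //= ler_piMr ?(ltW (p_gt0 _)) //.
  by apply: prodr_ile1 => b _; rewrite ltW ?p_le1.
have q_le1 : q <= 1 by apply: prodr_ile1 => a _; rewrite ltW ?p_le1.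
apply: (@le_trans _ _ (q ^+ #|S|)); first exact: ler_wiXn2l.
by rewrite -prodr_const ler_prod // => v _; rewrite q_ge0 qp.
Qed.

(* Chebyshev's inequality for the number of indices [e] whose pattern occurs:
   only pairs with intersecting supports contribute to the variance, each at
   most 1. *)
Lemma no_agree_weight (I : finType) (A : {set I}) (S : I -> {set V})
    (s : I -> {ffun V -> T}) (c : R) (B : pred {ffun V -> T}) :
    0 <= c -> (forall e, e \in A -> c <= pattern_weight (S e) (s e)) ->
    (forall t e, B t -> e \in A -> ~~ agree (S e) (s e) t) ->
  (c * #|A|%:R) ^+ 2 * \sum_(t | B t) prod_weight t <=
    \sum_(e in A) \sum_(f in A) (~~ [disjoint S e & S f])%:R.
Proof.
move=> c_ge0 cS BA.
pose q e := pattern_weight (S e) (s e).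
pose X e t : R := (agree (S e) (s e) t)%:R.
pose Z t := \sum_(e in A) (X e t - q e).
(* On [B] every indicator vanishes, so [Z] is minus the expected count, which is at least
   [c * #|A|]. *)
have ZB t : B t -> (c * #|A|%:R) ^+ 2 <= Z t ^+ 2.
  move=> Bt; have -> : Z t = - \sum_(e in A) q e.
    rewrite /Z -sumrN; apply: eq_bigr => e eA.
    by rewrite /X (negPf (BA _ _ Bt eA)) sub0r.
  rewrite sqrrN lerXn2r ?nnegrE ?mulr_ge0 ?ler0n //.
    by apply: sumr_ge0 => e _; apply: pattern_weight_ge0.
  rewrite mulr_natr -sumr_const.
  by apply: ler_sum => e /cS.
apply: (@le_trans _ _ (\sum_t prod_weight t * Z t ^+ 2)).
  rewrite mulr_sumr big_mkcond; apply: ler_sum => t _.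
  have w0 := prod_weight_ge0 t.
  case: ifP => [Bt|_]; last by rewrite mulr_ge0 ?sqr_ge0.
  by rewrite mulrC ler_wpM2l ?ZB.
under eq_bigr => t _ do rewrite expr2 /Z big_distrlr /= mulr_sumr.
rewrite exchange_big /=; apply: ler_sum => e eA.
under eq_bigr => t _ do rewrite mulr_sumr.
rewrite exchange_big /=; apply: ler_sum => f fA.
have -> : \sum_t prod_weight t * ((X e t - q e) * (X f t - q f)) =
    \sum_t prod_weight t * (X e t * X f t) - q e * q f.
  transitivity (\sum_t prod_weight t * (X e t * X f t)
    - q f * (\sum_t prod_weight t * X e t)
    - q e * (\sum_t prod_weight t * X f t)
    + q e * q f * \sum_t prod_weight t).
    rewrite !mulr_sumr -!sumrN -!big_split /=.
    by apply: eq_bigr => t _; ring.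
  rewrite !sum_agree sum_prod_weight1 -/(q e) -/(q f); ring.
case: (boolP [disjoint S e & S f]) => dis /=.
  by rewrite sum_agree2 // subrr.
(* Overlapping supports: drop the product of the means and bound the joint probability by 1. *)
rewrite lerBlDr; apply: (@le_trans _ _ 1); last first.
  by rewrite lerDl mulr_ge0 ?pattern_weight_ge0.
rewrite -sum_prod_weight1; apply: ler_sum => t _.
rewrite ler_piMr ?prod_weight_ge0 // /X -natrM -[leRHS](mulr1n 1) ler_nat.
by case: agree; case: agree.
Qed.

End ProductWeight.

(** * The bound for a fixed graph *)

(** Each intersecting pair is charged to a vertex common to both supports. *)
Lemma sum_intersecting_pairs (V I : finType) (A : {set I}) (S : I -> {set V}) :
  (\sum_(e in A) \sum_(f in A) ~~ [disjoint S e & S f] <=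
    \sum_v #|[set e in A | v \in S e]%SET| ^ 2)%N.
Proof.
have cardE v : #|[set e in A | v \in S e]%SET| = (\sum_(e in A) (v \in S e))%N.
  by rewrite -sum1_card big_mkcond [RHS]big_mkcond; apply: eq_bigr => e _;
    rewrite inE; case: (e \in A); case: (v \in S e).
under [leqRHS]eq_bigr do rewrite cardE -mulnn big_distrlr /=.
rewrite [leqRHS]exchange_big; apply: leq_sum => e _.
rewrite [leqRHS]exchange_big; apply: leq_sum => f _.
case: (boolP [disjoint _ & _]) => //= /pred0Pn[v /andP[/= ve vf]].
by rewrite (bigD1 v) //= ve vf.
Qed.
(** The exponent [k.*2] bounds the number of players in a pattern; the right side sums the squares
    of [k * degree G v], which bounds the number of edge neighbourhoods through [v]. *)
Lemma PNE_weight_bound (R : realFieldType) (V : finType) (m : nat)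
    (p : player_type m -> R) (G : sgraph V) (A : {set {set V}}) (k : nat) :
    (1 < m)%N -> (forall a, 0 < p a) -> \sum_a p a = 1 ->
    {subset A <= edges G} ->
    (forall e i, e \in A -> i \in e ->
      (degree G i == 1 %[mod m])%N && (degree G i <= k)%N) ->
  ((\prod_a p a) ^+ k.*2 * #|A|%:R) ^+ 2 *
    \sum_(t : {ffun V -> player_type m} | `[< has_PNE G t >]) prod_weight p t <=
  k%:R ^+ 2 * \sum_v (degree G v)%:R ^+ 2.
Proof.
move=> m1 p_gt0 p_sum1 AG deg.
have degm e i : e \in A -> i \in e -> (degree G i == 1 %[mod m])%N.
  by move=> eA /(deg _ _ eA)/andP[].
have degk e i : e \in A -> i \in e -> (degree G i <= k)%N.
  by move=> eA /(deg _ _ eA)/andP[].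
have /choice[s sP] : forall e : {set V}, exists s : {ffun V -> player_type m},
    e \in A -> forall t : {ffun V -> player_type m},
    agree (edge_nbhd G e) s t -> ~ has_PNE G t.
  (* Off [A] the pattern is an arbitrary default, so that [choice] yields a total function. *)
  move=> e; case: (boolP (e \in A)) => [eA|_]; last by exists [ffun=> Conformist].
  have [s sP] := exists_no_PNE_pattern m1 (AG _ eA) (fun i => degm e i eA).
  by exists s => _ t /forall_inP ts; apply: sP => v /ts/eqP.
have := @no_agree_weight R V _ p p_gt0 p_sum1 _ A (edge_nbhd G) s
  ((\prod_a p a) ^+ k.*2) (fun t => `[< has_PNE G t >]).
move=> /(_ _ _ _)/le_trans; apply.
- by rewrite exprn_ge0 // prodr_ge0 // => a _; apply: ltW.
- move=> e eA; apply: pattern_weight_lb => //.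
  by apply: card_edge_nbhd; [exact: AG|move=> i; exact: degk].
- move=> t e /asboolP tP eA; apply/negP => /(sP e eA t); exact.
- under eq_bigr do rewrite -natr_sum.
  rewrite -natr_sum mulr_sumr.
  under [leRHS]eq_bigr do rewrite -exprMn -natrM -natrX.
  rewrite -natr_sum ler_nat.
  apply: leq_trans (sum_intersecting_pairs A (edge_nbhd G)) _.
  apply: leq_sum => v _; rewrite leq_sqr.
  exact: card_edges_near.
Qed.

Local Open Scope classical_set_scope.

(** * From a fixed graph to the random graph *)

Section FiniteLaw.
Context d (T : measurableType d) (R : realType) (P : probability T R).

Lemma measure_finType_bigcup (I : finType) (D : pred I) (F : I -> set T) :
    (forall i, measurable (F i)) -> trivIset [set: I] F ->
  P (\bigcup_(i in [set i | D i]) F i) = (\sum_(i | D i) P (F i))%E.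
Proof.
move=> mF tF; have -> : [set i | D i] = [set` enum D].
  by apply/seteqP; split=> i /=; rewrite mem_enum.
rewrite measure_fin_bigcup //; last exact: sub_trivIset tF.
by rewrite -fsbig_seq ?enum_uniq // big_enum.
Qed.

Context (m : nat) (V : finType) (G : {RV P >-> sgraph V})
  (tau : V -> {RV P >-> player_type m}) (p : player_type m -> R).
Hypothesis law : forall i t, P (tau i @^-1` [set t]) = (p t)%:E.
Hypothesis indep : types_and_graph_independent G tau.

(** The atoms of the finite partition of [T] by the realised graph and types. *)
Let cell (gt : sgraph V * {ffun V -> player_type m}) : set T :=
  [set w | G w = gt.1 /\ forall i, tau i w = gt.2 i].

Lemma measurable_RV_preimage d' (T' : measurableType d') (X : {RV P >-> T'})
    (A : set T') : measurable A -> measurable (X @^-1` A).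
Proof. by move=> mA; rewrite -[X in measurable X]setTI; apply: measurable_funPT. Qed.

Let event (gt : sgraph V * {ffun V -> player_type m}) (o : option V) : set T :=
  if o is Some i then tau i @^-1` [set gt.2 i] else G @^-1` [set gt.1].

Let cellE gt : cell gt = \bigcap_(o in [set` [set: option V]%SET]) event gt o.
Proof.
apply/seteqP; split=> w.
  by move=> [Gw tw] [i|] _ //=; apply: tw.
move=> H; split; first by apply: (H None); rewrite /= inE.
by move=> i; apply: (H (Some i)); rewrite /= inE.
Qed.

Let measurable_event gt o : measurable (event gt o).
Proof. by case: o => [i|]; apply: measurable_RV_preimage. Qed.

Let measurable_cell gt : measurable (cell gt).
Proof.
rewrite cellE; apply: fin_bigcap_measurable; first exact: finite_finpred.
by move=> o _; apply: measurable_event.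
Qed.

Let prob_cell gt :
  P (cell gt) = (P (G @^-1` [set gt.1]) * (prod_weight p gt.2)%:E)%E.
Proof.
rewrite cellE indep; last first.
  by move=> [i|] _; [exists [set gt.2 i]|exists [set gt.1]]; rewrite // setTI.
under eq_bigl do rewrite inE.
rewrite (bigD1 None) //=; congr (_ * _)%E.
rewrite /prod_weight -prodEFin (reindex_omap Some id) => [|[]] //=.
by apply: eq_big => [i|i _]; rewrite ?eqxx // law.
Qed.

(* Conditionally on the graph the types have the product law, so a bound valid
   for almost every realisation of the graph bounds the probability. *)
Lemma prob_le_conditional_weight (Q : sgraph V -> (V -> player_type m) -> Prop)
    (c : R) : 0 <= c ->
    {ae P, forall w, \sum_(t : {ffun V -> player_type m} | `[< Q (G w) t >])
      prod_weight p t <= c} ->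
  (P [set w | Q (G w) (fun i => tau i w)] <= c%:E)%E.
Proof.
move=> c_ge0 aeP.
have -> : [set w | Q (G w) (fun i => tau i w)] =
    \bigcup_(gt in [set gt : sgraph V * {ffun V -> player_type m} |
      `[< Q gt.1 gt.2 >]]) cell gt.
  apply/seteqP; split=> w /=.
    move=> Qw; exists (G w, [ffun i => tau i w]) => /=; last first.
      by split=> // i; rewrite ffunE.
    apply/asboolP; congr (Q _ _): Qw; apply/funext => i; by rewrite ffunE.
  move=> [[g t] /= /asboolP Qgt [/= -> tw]].
  by congr (Q _ _): Qgt; apply/funext => i; rewrite tw.
rewrite measure_finType_bigcup //; last first.
  apply/trivIsetP => -[g t] [g' t'] _ _; apply: contra_neqP => /eqP/set0P[w].
  move=> [[/= Gw tw] [/= Gw' tw']]; congr pair; first by rewrite -Gw -Gw'.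
  by apply/ffunP => i; rewrite -tw -tw'.
under eq_bigr do rewrite prob_cell.
rewrite -(pair_big_dep xpredT
  (fun g (t : {ffun V -> player_type m}) => `[< Q g t >])
  (fun g (t : {ffun V -> player_type m}) => (P (G @^-1` [set g]) * (prod_weight p t)%:E)%E)) /=.
have PG1 : (\sum_g P (G @^-1` [set g]) = 1)%E.
  rewrite -measure_finType_bigcup //.
  - rewrite -[RHS](@probability_setT _ _ _ P); congr (P _).
    by apply/seteqP; split=> // w _; exists (G w).
  - by move=> g; apply: measurable_RV_preimage.
  - by apply/trivIsetP => g g' _ _; apply: contra_neqP => /eqP/set0P[w [/= <- <-]].
(* Spreading [c] over the graphs, with weights summing to 1, makes the comparison termwise. *)
rewrite -[leRHS]mule1 -PG1 ge0_sume_distrr //.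
apply: lee_sum => g _.
rewrite -ge0_sume_distrr; last first.
  by move=> t _; rewrite lee_fin prodr_ge0 // => i _; rewrite -lee_fin -(law i).
rewrite sumEFin muleC.
(* A graph violating the bound has its whole preimage inside the exceptional null set, so its term
   vanishes. *)
case: (lerP (\sum_(t : {ffun V -> player_type m} | `[< Q g t >]) prod_weight p t) c) => [le_c|gt_c].
  by rewrite lee_wpmul2r // lee_fin.
suff -> : P (G @^-1` [set g]) = 0%E by rewrite !mule0.
apply: measure_negligible; first exact: measurable_RV_preimage.
apply: negligibleS aeP => w /= ->.
by apply/negP; rewrite -ltNge.
Qed.

End FiniteLaw.

(** * Decay rate and the limit *)

Lemma PNE_weight_le (R : realType) (n m : nat) (p : player_type m -> R)
    (G : sgraph 'I_n) (k : nat) (alpha K M : R) :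
    (1 < m)%N -> (forall a, 0 < p a) -> \sum_a p a = 1 ->
    (0 < n)%N -> 0 < alpha -> K <= k%:R ->
    (\sum_(i < n) (degree G i)%:R ^+ 2) / n%:R <= M ->
    alpha * n%:R <=
      #|induced_edges G [set i : 'I_n | (degree G i == 1 %[mod m])%N
                           && ((degree G i)%:R <= K)]%SET|%:R ->
  \sum_(t : {ffun 'I_n -> player_type m} | `[< has_PNE G t >]) prod_weight p t
    <= k%:R ^+ 2 * M / ((\prod_a p a) ^+ k.*2 * alpha) ^+ 2 / n%:R.
Proof.
move=> m1 p_gt0 p_sum1 n0 alpha0 Kk momM.
set A := induced_edges _ _ => edgesA; set W := \sum_(t | _) _.
have n0R : (0 : R) < n%:R by rewrite ltr0n.
have AG : {subset A <= edges G} by move=> e; rewrite inE => /andP[].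
have degA e i : e \in A -> i \in e ->
    (degree G i == 1 %[mod m])%N && (degree G i <= k)%N.
  rewrite inE => /andP[_ /fintype.subsetP eA] /eA.
  by rewrite inE => /andP[-> /le_trans/(_ Kk)]; rewrite ler_nat.
have := PNE_weight_bound m1 p_gt0 p_sum1 AG degA.
set c := (\prod_a p a) ^+ k.*2 => weightW.
have c_gt0 : 0 < c by rewrite exprn_gt0 // prodr_gt0.
have W_ge0 : 0 <= W by apply: sumr_ge0 => t _; apply: prod_weight_ge0.
rewrite !ler_pdivlMr ?exprn_gt0 ?mulr_gt0 //.
(* The extra factor [n%:R] pairs with [alpha] on the left to match the edge count, and with [M] on
   the right to match the sum of squared degrees. *)
rewrite -(ler_pM2r n0R).
have momM' : \sum_(i < n) (degree G i)%:R ^+ 2 <= M * n%:R.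
  by rewrite -ler_pdivrMr.
apply: (@le_trans _ _ ((c * #|A|%:R) ^+ 2 * W)).
  have -> : W * n%:R * (c * alpha) ^+ 2 * n%:R = (c * (alpha * n%:R)) ^+ 2 * W.
    by ring.
  rewrite ler_wpM2r // lerXn2r ?nnegrE ?mulr_ge0 ?ler0n ?(ltW c_gt0) ?(ltW alpha0) //.
  by rewrite ler_pM2l.
apply: le_trans weightW _.
by rewrite -[leRHS]mulrA ler_wpM2l ?exprn_ge0.
Qed.

Unset Implicit Arguments.

Theorem theorem2 (R : realType) (m : nat) (m_ge2 : (2 <= m)%N)
  (pi : player_type m -> R)
  (pi_gt0 : forall t : player_type m, 0 < pi t)
  (pi_sum1 : \sum_(t : player_type m) pi t = 1)
  (d : nat -> measure_display)
  (T : forall n : nat, measurableType (d n))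
  (P : forall n : nat, probability (T n) R)
  (G : forall n : nat, {RV (P n) >-> sgraph 'I_n})
  (tau : forall n : nat, 'I_n -> {RV (P n) >-> player_type m})
  (bounded_second_moment :
    exists M : R, forall n : nat, (0 < n)%N ->
      {ae P n, forall w : T n,
        (\sum_(i < n) (degree (G n w) i)%:R ^+ 2) / n%:R <= M})
  (many_edges :
    exists alpha : R, exists K : R, 0 < alpha /\ 0 < K /\
      \forall n \near \oo,
        {ae P n, forall w : T n,
          alpha * n%:R <=
          #|induced_edges (G n w)
              [set i : 'I_n | (degree (G n w) i == 1 %[mod m])%N
                              && ((degree (G n w) i)%:R <= K)]%SET|%:R})
  (types_law : forall (n : nat) (i : 'I_n) (t : player_type m),
    P n (tau n i @^-1` [set t]) = (pi t)%:E)
  (types_indep : forall n : nat,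
    types_and_graph_independent (G n) (tau n)) :
  P n [set w | has_PNE (G n w) (fun i : 'I_n => tau n i w)] @[n --> \oo]
    --> 0%E.
Proof.
case: bounded_second_moment => M momM.
case: many_edges => alpha [K [alpha0 [K0 edgesK]]].
pose k := Num.bound K.
have Kk : K <= k%:R by rewrite ltW // archi_boundP // ltW.
pose c : R := (\prod_t pi t) ^+ k.*2 * alpha.
have c0 : 0 < c by rewrite mulr_gt0 // exprn_gt0 // prodr_gt0.
(* The absolute value makes [C] nonnegative outright. *)
pose C : R := k%:R ^+ 2 * `|M| / c ^+ 2.
have C0 : 0 <= C.
  apply: divr_ge0; last exact: exprn_ge0 (ltW c0).
  by apply: mulr_ge0; [exact: exprn_ge0|exact: normr_ge0].
(* The sequence [harmonic] is 1/(n+1), and 1/n <= 2/(n+1) for n >= 1; hence the factor 2. *)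
have bound : \forall n \near \oo,
    (0 <= P n [set w | has_PNE (G n w) (fun i => tau n i w)]
       <= ((C * 2) * @harmonic R n)%:E)%E.
  apply: filterS2 (nbhs_infty_gt 0) edgesK => n n0 edgesn.
  rewrite measure_ge0 /=.
  apply: (@le_trans _ _ (C / n%:R)%:E); last first.
    rewrite lee_fin -mulrA ler_wpM2l // ler_pdivlMr ?ltr0n // mulrC.
    by rewrite ler_pdivrMr ?ltr0n // -natrM ler_nat; lia.
  apply: (prob_le_conditional_weight (types_law n) (types_indep n)).
    by rewrite divr_ge0.
  apply: filterS2 (momM n n0) edgesn => w momw edgw.
  apply: PNE_weight_le edgw => //.
  exact: le_trans momw (ler_norm M).
apply: (squeeze_cvge bound); first exact: cvg_cst.
apply: cvg_EFin; first exact: nearW.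
rewrite -(mulr0 (C * 2)); apply: cvgMl_tmp; exact: cvg_harmonic.
Qed.
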